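(* Let $F$ be a properly parametrized Markov multi-map of $[0,1]$ with forward trajectory system $(X,T)$ and associated shift of finite type $\Sigma_M$. (1) If $(X,T)$ is topologically transitive, then $\Sigma_M$ satisfies the Irreducibility Condition (IC). (2) If $\Sigma_M$ satisfies the Coding Condition (CC) and the Irreducibility Condition (IC), then $(X,T)$ is topologically transitive and its periodic points are dense in $X$.
   Context: **Markov multi-maps.** $2^{[0,1]}$ denotes the set of closed subsets of $[0,1]$. A Markov multi-map of $[0,1]$ is given by a tuple $F=(P,\mathcal{A}_0,\mathcal{A}_1,\mathcal{A}_2,D,R,\{f_a\}_{a\in\mathcal{A}_0})$ such that: (1) $P=\{p_0,\dots,p_r\}$ with $0=p_0<\dots<p_r=1$; (2) $\mathcal{A}=\mathcal{A}_0\sqcup\mathcal{A}_1\sqcup\mathcal{A}_2$ is a finite set; (3) $D:\mathcal{A}\to 2^{[0,1]}$, and for each $a\in\mathcal{A}$ there is $p_i\in P$ with $D(a)=[p_i,p_{i+1}]$ if $a\in\mathcal{A}_0$ and $D(a)=\{p_i\}$ if $a\in\mathcal{A}_1\cup\mathcal{A}_2$; (4) $R:\mathcal{A}\to 2^{[0,1]}$, and for each $a\in\mathcal{A}$ there are $u\le v$ in $P$ with $R(a)=[u,v]$, where $u<v$ if $a\in\mathcal{A}_0$; $u<v$ and $R(a)\cap P=\{u,v\}$ if $a\in\mathcal{A}_1$; $u=v$ if $a\in\mathcal{A}_2$; (5) for each $a\in\mathcal{A}_0$, $f_a:D(a)\to R(a)$ is a homeomorphism; (6) $[0,1]=\bigcup_{a\in\mathcal{A}}D(a)$.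 For $a\in\mathcal{A}_0$ let $G(a)$ be the graph of $f_a$; for $a\in\mathcal{A}_1\cup\mathcal{A}_2$ let $G(a)=D(a)\times R(a)$. The multi-map $F:[0,1]\to 2^{[0,1]}$ has graph $G(F)=\bigcup_{a\in\mathcal{A}}G(a)$, i.e. $y\in F(x)$ iff $(x,y)\in G(F)$. If $a\in\mathcal{A}_0$ with $D(a)=[p_i,p_{i+1}]$, $R(a)=[u,v]$: $D_0(a)=(p_i,p_{i+1})$, $R_0(a)=(u,v)$, $G_0(a)$ = graph of $f_a|_{D_0(a)}$. If $a\in\mathcal{A}_1$ with $D(a)=\{p\}$, $R(a)=[u,v]$: $D_0(a)=\{p\}$, $R_0(a)=(u,v)$, $G_0(a)=\{p\}\times(u,v)$. If $a\in\mathcal{A}_2$ with $D(a)=\{p\}$, $R(a)=\{q\}$: $D_0(a)=\{p\}$, $R_0(a)=\{q\}$, $G_0(a)=\{(p,q)\}$. $F$ is properly parametrized if $\{G_0(a):a\in\mathcal{A}\}$ is a partition of $G(F)$. **Trajectories.** $X=\{x\in[0,1]^{\mathbb{Z}_{\ge0}}:x_{k+1}\in F(x_k)\ \forall k\ge0\}$ with the subspace topology of the product topology, and $T:X\to X$, $T(x)_k=x_{k+1}$. For $n\ge 1$, $X_n=\{(x_0,\dots,x_{n-1})\in[0,1]^n:(x_i,x_{i+1})\in G(F),\ 0\le i\le n-2\}$ with the subspace topology. A system $(X,T)$ is topologically transitive if for all nonempty open $U,V\subset X$ there is $n\ge0$ with $T^n(U)\cap V\ne\emptyset$; a point $x$ is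 periodic if $T^p(x)=x$ for some $p\ge1$. **Associated SFT.** $M(a,b)=1$ if $D_0(b)\subset R_0(a)$ and $M(a,b)=0$ otherwise ($a,b\in\mathcal{A}$). $\Sigma_M=\{\mathbf{a}\in\mathcal{A}^{\mathbb{Z}_{\ge0}}:M(a_n,a_{n+1})=1\ \forall n\ge 0\}$, with left shift $\sigma$. For $Z\subset\Sigma_M$, $\mathcal{L}_n(Z)$ is the set of words of length $n$ appearing in points of $Z$, $\mathcal{L}(Z)=\bigcup_n\mathcal{L}_n(Z)$; $\mathcal{L}_n=\mathcal{L}_n(\Sigma_M)$, $\mathcal{L}=\mathcal{L}(\Sigma_M)$. For $\mathcal{C}\subset\mathcal{A}$, $\Sigma_M(\mathcal{C})$ is the set of points of $\Sigma_M$ using only symbols of $\mathcal{C}$, and $\mathcal{L}(\mathcal{C})=\mathcal{L}(\Sigma_M(\mathcal{C}))$. A subshift $Z\subset\Sigma_M$ is a closed set with $\sigma(Z)\subset Z$; it is transitive on symbols if for all $a,b\in\mathcal{L}_1(Z)$ some word in $\mathcal{L}(Z)$ starts with $a$ and ends with $b$. **Inverse functions.** For $a\in\mathcal{A}_0$, $g_a=f_a^{-1}$; for $a\in\mathcal{A}_1\cup\mathcal{A}_2$, $g_a:R(a)\to D(a)$ is the constant map. For $u=u_0\cdots u_n\in\mathcal{L}$, $g_u=g_{u_0}\circ\cdots\circ g_{u_n}$ (defined on $R(u_n)$) and $I_u=g_u(R(u_n))$. For a possibly degenerate interval, $\ell([p,q])=q-p$. **Coding Condition (CC).** There is a subshift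 $Z\subset\Sigma_M$, transitive on symbols, such that (i) for every $y\in[0,1]$ there are $\mathbf{a}\in Z$ and $x\in X$ with $x_0=y$ and $(x_i,x_{i+1})\in G(a_i)$ for all $i\ge0$; and (ii) $\lim_{n\to\infty}\max_{u\in\mathcal{L}_n(Z)}\ell(I_u)=0$. **Essential symbols.** A word $u=u_0\cdots u_{n-1}\in\mathcal{L}_n$ is essential if $\{x\in X_{n+1}:(x_k,x_{k+1})\in G_0(u_k),\ 0\le k\le n-1\}$ is open in $X_{n+1}$. A symbol is essential if it appears in some essential word; $\mathcal{A}^{(e)}$ is the set of essential symbols. **Irreducibility Condition (IC).** A set $\mathcal{C}\subset\mathcal{A}$ is irreducible if for all $a,b\in\mathcal{C}$ there is a word in $\mathcal{L}(\mathcal{C})$ beginning with $a$ and ending with $b$; an irreducible component is a maximal irreducible subset of $\mathcal{A}$. $\Sigma_M$ satisfies (IC) if there is an irreducible component $\mathcal{C}\subset\mathcal{A}$ with $\mathcal{A}^{(e)}\subset\mathcal{C}$. *)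

(* Defs.v *)
From HB Require Import structures.
From mathcomp Require Import all_boot all_order all_algebra.
From mathcomp Require Import all_classical all_reals all_analysis.
Set Implicit Arguments.
Unset Strict Implicit.
Unset Printing Implicit Defensive.
Import Order.TTheory GRing.Theory Num.Theory.
Import numFieldNormedType.Exports.
Local Open Scope classical_set_scope.
Local Open Scope ring_scope.

Definition topologically_transitive (X : topologicalType) (T : X -> X) : Prop :=
  forall U V : set X, open U -> open V -> U !=set0 -> V !=set0 ->
    exists n : nat, (iter n T @` U) `&` V !=set0.

Definition periodic_points (X : Type) (T : X -> X) : set X :=
  [set x | exists2 p : nat, (0 < p)%N & iter p T x = x].

Definition homeomorphism_on (U V : topologicalType) (u0 : U)
    (A : set U) (B : set V) (f : U -> V) : Prop :=
  [/\ set_bij A B f,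
      {within A, continuous f} &
      {within B, continuous ('pinv_(fun=> u0) A f)}].

(* The partition of the alphabet into A_0, A_1, A_2 is given by a map
   from symbols to [symbol_class]. *)
Variant symbol_class := Class0 | Class1 | Class2.

(* Only [pt 0, ..., pt r] are used, and [branch a] is used only when [a] is of
   class [Class0] and only on D(a). The set D(a) is given by its end points
   [dlo a, dhi a], and R(a) by [rlo a, rhi a]. *)
Record multimap_data (R : realType) := MultimapData {
  nparts : nat;
  pt : nat -> R;
  symb : finType;
  class_of : symb -> symbol_class;
  dlo : symb -> R;
  dhi : symb -> R;
  rlo : symb -> R;
  rhi : symb -> R;
  branch : symb -> R -> R }.

Section Markov_data.
Context {R : realType} (F : multimap_data R).
Implicit Types a : symb F.

Definition partition_points : set R :=
  [set pt F i | i in [set i | (i <= nparts F)%N]].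

Definition Dom a : set R := `[dlo a, dhi a].

Definition Rng a : set R := `[rlo a, rhi a].

Definition Dom0 a : set R :=
  if class_of a is Class0 then `]dlo a, dhi a[ else [set dlo a].

Definition Rng0 a : set R :=
  if class_of a is Class2 then [set rlo a] else `]rlo a, rhi a[.

Definition Gr a : set (R * R) :=
  if class_of a is Class0 then [set z | Dom a z.1 /\ z.2 = branch a z.1]
  else Dom a `*` Rng a.

Definition Gr0 a : set (R * R) :=
  if class_of a is Class0 then [set z | Dom0 a z.1 /\ z.2 = branch a z.1]
  else Dom0 a `*` Rng0 a.

Definition multigraph : set (R * R) := \bigcup_a Gr a.

Record Markov_axioms : Prop := MarkovAxioms {
  pt_first : pt F 0 = 0;
  pt_last : pt F (nparts F) = 1;
  pt_increasing : forall i, (i < nparts F)%N -> pt F i < pt F i.+1;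
  DomP : forall a,
    if class_of a is Class0 then
      exists2 i, (i < nparts F)%N & dlo a = pt F i /\ dhi a = pt F i.+1
    else partition_points (dlo a) /\ dhi a = dlo a;
  Rng_ends : forall a, partition_points (rlo a) /\ partition_points (rhi a);
  RngP : forall a,
    match class_of a return Prop with
    | Class0 => rlo a < rhi a
    | Class1 => rlo a < rhi a /\
                Rng a `&` partition_points = [set rlo a; rhi a]
    | Class2 => rlo a = rhi a
    end;
  branchP : forall a, class_of a = Class0 ->
    homeomorphism_on 0 (Dom a) (Rng a) (branch a);
  Dom_cover : \bigcup_a Dom a = `[0, 1]%classic }.

End Markov_data.

Record Markov_multimap (R : realType) := MarkovMultimap {
  multimap_of :> multimap_data R;
  multimap_axioms : Markov_axioms multimap_of }.

Section Markov_multimaps.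
Context {R : realType} (F : Markov_multimap R).
Implicit Types (a b : symb F) (C : set (symb F)).

(* A partition as an indexed family: distinct symbols have disjoint [Gr0]. *)
Definition properly_parametrized : Prop :=
  partition [set: symb F] (@Gr0 R F) (multigraph F).

Definition trajectories : set {ptws nat -> R} :=
  [set x | (forall k, `[0, 1]%classic (x k)) /\
           (forall k, multigraph F (x k, x k.+1))].

Definition X : topologicalType := set_type trajectories.

Lemma T_subproof (x : X) :
  (fun k => set_val x k.+1) \in trajectories.
Proof.
have [x01 xF] := set_mem (valP x).
by apply/mem_set; split=> k; [exact: x01|exact: xF].
Qed.

Definition T (x : X) : X :=
  exist _ (fun k => set_val x k.+1) (T_subproof x).

Definition finite_trajectories (n : nat) : set {ptws 'I_n -> R} :=
  [set x | (forall i, `[0, 1]%classic (x i)) /\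
           (forall i j : 'I_n, j = i.+1 :> nat -> multigraph F (x i, x j))].

Definition X_ (n : nat) : topologicalType := set_type (@finite_trajectories n).

Definition M a b : bool := `[< Dom0 b `<=` Rng0 a >].

Definition Sigma_M : set (nat -> symb F) := [set s | forall n, M (s n) (s n.+1)].

Definition Sigma_on C : set (nat -> symb F) :=
  [set s | Sigma_M s /\ forall n, C (s n)].

Definition words (n : nat) (Z : set (nat -> symb F)) : set (n.-tuple (symb F)) :=
  [set w | exists2 s, Z s & exists k, forall i : 'I_n, tnth w i = s (k + i)%N].

Definition language (Z : set (nat -> symb F)) : set (seq (symb F)) :=
  [set w | words Z (in_tuple w)].

Definition starts_ends a b (w : seq (symb F)) : Prop :=
  exists w', w = a :: w' /\ last a w' = b.

Definition subshift (Z : set (nat -> symb F)) : Prop :=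
  [/\ Z `<=` Sigma_M,
      closed (Z : set {ptws nat -> discrete_topology (symb F)}) &
      forall s, Z s -> Z (fun n => s n.+1)].

Definition transitive_on_symbols (Z : set (nat -> symb F)) : Prop :=
  forall a b, words Z [tuple a] -> words Z [tuple b] ->
    exists2 w, language Z w & starts_ends a b w.

Definition inverse_branch a : R -> R :=
  if class_of a is Class0 then 'pinv_(fun=> 0) (Dom a) (branch a)
  else fun=> dlo a.

Definition inverse_word (u : seq (symb F)) : R -> R :=
  foldr (fun a h => inverse_branch a \o h) id u.

(* The value on the empty word plays no role. *)
Definition I_ (u : seq (symb F)) : set R :=
  if u is a :: u' then inverse_word u @` Rng (last a u') else set0.

Definition ell (I : set R) : R := sup I - inf I.

Definition coding_condition : Prop :=
  exists Z, [/\ subshift Z, transitive_on_symbols Z,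
    forall y, `[0, 1]%classic y -> exists s (x : nat -> R),
      [/\ Z s, trajectories x, x 0%N = y & forall i, Gr (s i) (x i, x i.+1)] &
    (fun n => \big[Num.max/0]_(u : n.-tuple (symb F) | `[< words Z u >])
                 ell (I_ u)) @ \oo --> (0 : R)].

Definition essential_word (n : nat) (u : n.-tuple (symb F)) : Prop :=
  words Sigma_M u /\
  open [set x : X_ n.+1 | forall k : 'I_n,
    Gr0 (tnth u k) (set_val x (widen_ord (leqnSn n) k),
                    set_val x (lift ord0 k))].

Definition essential_symbols : set (symb F) :=
  [set a | exists n (u : n.-tuple (symb F)), essential_word u /\ a \in u].

Definition irreducible C : Prop :=
  forall a b, C a -> C b ->
    exists2 w, language (Sigma_on C) w & starts_ends a b w.

Definition irreducible_component C : Prop :=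
  irreducible C /\ forall C', irreducible C' -> C `<=` C' -> C' = C.

Definition irreducibility_condition : Prop :=
  exists2 C, irreducible_component C & essential_symbols `<=` C.

End Markov_multimaps.

(* Main.v *)
(* Every trajectory has a unique code by symbols with x_k, x_{k+1} in G_0(a_k),
   and this code is an M-path; conversely every M-path is realised, backwards,
   by the inverse branches.

   (1) A cylinder of an essential word is open, and in a transitive Hausdorff
   system the preimage of a nonempty open set is nonempty; so a trajectory
   leads from the cylinder of a to that of b in an arbitrarily long time.  All
   essential symbols lie in one strongly connected class.

   (2) In a nonempty open set pick a trajectory whose code has as few symbols
   of class 2 as possible up to time n.  Only at points with both coordinates
   in P can G_0(a) be approached by other graphs, so the code of that
   trajectory is locally constant and its word is essential.  Following it by a
   long Z-word that codes x_n, the coding condition gives a word whose whole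
   weak cylinder (closed graphs) lies in the open set, with both ends in the
   component C.  Connecting such words inside C gives transitivity, and closing
   one up gives a periodic point, a fixed point of the inverse branch of a
   cycle. *)
Require Import Defs.
From mathcomp Require Import all_boot all_order all_algebra.
From mathcomp Require Import all_classical all_reals all_analysis.
From mathcomp Require Import lra zify.
Set Implicit Arguments.
Unset Strict Implicit.
Unset Printing Implicit Defensive.
Import Order.TTheory GRing.Theory Num.Theory.
Import numFieldNormedType.Exports.
Local Open Scope classical_set_scope.
Local Open Scope ring_scope.

(** * Continuity on subsets of the line *)

Lemma within_continuous_epsP (R : realType) (A : set R) (f : R -> R) :
  {within A, continuous f} <->
  forall x, A x -> forall e, 0 < e -> exists2 d, 0 < d &
    forall y, A y -> `|y - x| < d -> `|f y - f x| < e.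
Proof.
split=> [/subspace_continuousP cf x Ax e e0|H].
  have /(_ [set y | `|y - f x| < e]) := cf x Ax.
  case.
    by apply/nbhs_ballP; exists e => //= y; rewrite /ball/= distrC.
  move=> d /= d0 dP; exists d => // y Ay yx.
  by apply: dP => //=; rewrite distrC.
apply/subspace_continuousP => x Ax; apply/cvgrPdist_lt => e e0.
have [d d0 dP] := H _ Ax _ e0.
exists d => //= y /= yx Ay; rewrite distrC; apply: dP => //.
by rewrite distrC.
Qed.

(** A continuous injection on an interval is strictly monotone, so interior points go strictly
    between the images of the end points. *)
Lemma continuous_inj_itvoo (R : realType) (f : R -> R) (a b c d : R) :
  {within `[a, b], continuous f} -> {in `[a, b]%classic &, injective f} ->
  {homo f : x / `[a, b]%classic x >-> `[c, d]%classic x} ->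
  {homo f : x / `]a, b[%classic x >-> `]c, d[%classic x}.
Proof.
move=> cf injf hf x /= xab.
have injf' : {in `[a, b] &, injective f}.
  by move=> u v uI vI; apply: injf; rewrite inE.
have /andP[ax xb] : a < x < b by move: xab; rewrite in_itv.
have lab : a <= b by apply/ltW/(lt_trans ax).
have aI : a \in `[a, b] by rewrite in_itv/= lexx.
have bI : b \in `[a, b] by rewrite in_itv/= lexx andbT.
have xI : x \in `[a, b] by rewrite in_itv/= !ltW.
have := hf _ aI; have := hf _ bI; rewrite /= !in_itv/= => /andP[cb db] /andP[ca da].
have [fm|fm] := itv_continuous_inj_mono cf injf'.
  by rewrite (le_lt_trans ca) ?(lt_le_trans _ db)// fm.
by rewrite (le_lt_trans cb) ?(lt_le_trans _ da)// fm.
Qed.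

(** * Domains, ranges and graphs of single symbols *)

Section Symbols.
Context {R : realType} (F : Markov_multimap R).
Implicit Types (a b : symb F) (x y : R).

Notation P := (partition_points F).
Notation g := (@inverse_branch R F).

Lemma pt_le i j : (i <= j <= nparts F)%N -> pt F i <= pt F j.
Proof.
move=> /andP[ij jn]; elim: j ij jn => [|j IH]; first by rewrite leqn0 => /eqP->.
rewrite leq_eqVlt => /orP[/eqP->//|]; rewrite ltnS => ij jn.
apply: (le_trans (IH ij (ltnW jn))); apply/ltW.
exact: (pt_increasing (multimap_axioms F)).
Qed.

Lemma partition_points01 x : P x -> 0 <= x <= 1.
Proof.
move=> [i /= ir <-].
rewrite -{1}(pt_first (multimap_axioms F)) -(pt_last (multimap_axioms F)).
by rewrite !pt_le ?ir ?leqnn.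
Qed.

Lemma partition_point_gap i x : (i < nparts F)%N ->
  pt F i < x < pt F i.+1 -> ~ P x.
Proof.
move=> ir /andP[ix xi] [j /= jr jx]; move: ix xi; rewrite -jx.
have [ji|ij] := leqP j i.
  by rewrite ltNge pt_le// ji ltnW.
by move=> _; rewrite ltNge pt_le// ij.
Qed.

Lemma Dom_ends a : P (dlo a) /\ P (dhi a).
Proof.
have := DomP (multimap_axioms F) a; case: class_of => [[i ir [-> ->]]|[h ->]//|[h ->]//].
by split; [exists i => //=; exact: ltnW|exists i.+1].
Qed.

Lemma Dom01 a : Dom a `<=` `[0, 1].
Proof.
have [/partition_points01/andP[h1 _] /partition_points01/andP[_ h2]] := Dom_ends a.
move=> x; rewrite /Dom /= !in_itv/= => /andP[h3 h4].
by rewrite (le_trans h1 h3) (le_trans h4 h2).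
Qed.

Lemma Rng01 a : Rng a `<=` `[0, 1].
Proof.
have [/partition_points01/andP[h1 _] /partition_points01/andP[_ h2]] :=
  Rng_ends (multimap_axioms F) a.
move=> x; rewrite /Rng /= !in_itv/= => /andP[h3 h4].
by rewrite (le_trans h1 h3) (le_trans h4 h2).
Qed.

Lemma rlo_le_rhi a : rlo a <= rhi a.
Proof.
by have := RngP (multimap_axioms F) a; case: class_of => [/ltW//|[/ltW//]|->].
Qed.

Lemma Dom_point a x : class_of a <> Class0 -> Dom a x -> x = dlo a.
Proof.
rewrite /Dom /= in_itv/=; have := DomP (multimap_axioms F) a.
by case: class_of => [//|[_ ->]|[_ ->]] _ /le_anti/esym.
Qed.

Lemma Dom_dlo a : Dom a (dlo a).
Proof.
rewrite /Dom /= in_itv/= lexx/=; have := DomP (multimap_axioms F) a.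
case: class_of => [[i ir [-> ->]]|[_ ->]//|[_ ->]//].
exact/ltW/(pt_increasing (multimap_axioms F)).
Qed.

Lemma Dom0_sub a : Dom0 a `<=` Dom a.
Proof.
rewrite /Dom0 => x; case: class_of => [|->|->]; try exact: Dom_dlo.
by rewrite /Dom /= !in_itv/= => /andP[/ltW-> /ltW->].
Qed.

Lemma Rng0_sub a : Rng0 a `<=` Rng a.
Proof.
rewrite /Rng0 /Rng => x; have := rlo_le_rhi a.
case: class_of => [_|_|h -> /=]; last by rewrite in_itv/= lexx.
  by rewrite /= !in_itv/= => /andP[/ltW-> /ltW->].
by rewrite /= !in_itv/= => /andP[/ltW-> /ltW->].
Qed.

Lemma Gr0_sub a : Gr0 a `<=` Gr a.
Proof.
move=> [x y]; rewrite /Gr0 /Gr.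
have := @Dom0_sub a; have := @Rng0_sub a.
by case: (class_of a) => hR hD [/= /hD ? h]; split => //=; exact: hR.
Qed.

Lemma branch_bij a : class_of a = Class0 -> set_bij (Dom a) (Rng a) (branch a).
Proof. by move=> /(branchP (multimap_axioms F))[]. Qed.

Lemma Gr_inverse a x y : Gr a (x, y) -> Rng a y /\ x = g a y.
Proof.
rewrite /Gr /inverse_branch.
case E: class_of => -[/= Dx].
- move=> ->; have bij := branch_bij E; split.
    exact: set_bij_homo bij _ Dx.
  by rewrite pinvKV ?inE//; exact: set_bij_inj bij.
- by move=> Ry; split => //; apply: Dom_point => //; rewrite E.
- by move=> Ry; split => //; apply: Dom_point => //; rewrite E.
Qed.

Lemma Gr_Dom a x y : Gr a (x, y) -> Dom a x.
Proof. by rewrite /Gr; case: class_of => -[]. Qed.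

Lemma inverse_Gr a y : Rng a y -> Gr a (g a y, y).
Proof.
move=> Ry; rewrite /Gr /inverse_branch.
case E: class_of; try by split => //=; exact: Dom_dlo.
have bij := branch_bij E; split => /=.
  exact: (set_bij_homo (bijpinv_bij (fun=> 0) bij)) Ry.
by rewrite (surjpK _ (set_bij_surj bij)) ?inE.
Qed.

Lemma inverse_continuous a : {within Rng a, continuous (g a)}.
Proof.
rewrite /inverse_branch; case E: class_of.
- by have [] := branchP (multimap_axioms F) E.
- by apply: continuous_subspaceT => x; exact: cvg_cst.
- by apply: continuous_subspaceT => x; exact: cvg_cst.
Qed.

Lemma inverse_Gr0 a y : Rng0 a y -> Gr0 a (g a y, y).
Proof.
move=> Ry; have := inverse_Gr (Rng0_sub Ry); move: Ry.
rewrite /Gr /Gr0 /Dom0 /Rng0 /inverse_branch; case E: class_of => Ry [/= h1 h2] //.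
have [bij c1 c2] := branchP (multimap_axioms F) E.
split => //=; have pb := bijpinv_bij (fun=> 0) bij.
exact: (continuous_inj_itvoo c2 (set_bij_inj pb) (set_bij_homo pb)).
Qed.

Lemma Gr0_Dom0 a x y : Gr0 a (x, y) -> Dom0 a x.
Proof. by rewrite /Gr0 /Dom0; case: class_of => -[]. Qed.

Lemma Gr0_Rng0 a x y : Gr0 a (x, y) -> Rng0 a y.
Proof.
rewrite /Gr0 /Dom0 /Rng0; case E: class_of => -[] //= Dx ->.
have [bij c1 c2] := branchP (multimap_axioms F) E.
exact: (continuous_inj_itvoo c1 (set_bij_inj bij) (set_bij_homo bij)).
Qed.

(* The Markov property: a set [R0 a] is a union of sets [D0 b]. When [R0 a] is
   open it suffices that it meets the closed set [D b]. *)
Lemma Dom0_sub_Rng0 a b x : Rng0 a x -> Dom b x ->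
  class_of a <> Class2 \/ Dom0 b x -> Dom0 b `<=` Rng0 a.
Proof.
have [[i ir ilo] [j jr jhi]] := Rng_ends (multimap_axioms F) a.
rewrite /= in ir jr.
have open_case u v : P u -> P v -> u < x < v -> Dom b x ->
    Dom0 b `<=` `]u, v[.
  move=> [m /= mr <-] [n /= nr <-] /andP[mx xn].
  rewrite /Dom /Dom0 /= in_itv/=; have := DomP (multimap_axioms F) b.
  case: class_of => [[k kr [-> ->]]|[_ ->]|[_ ->]]; last first.
  - by move=> /le_anti E y ->; rewrite /= in_itv/= E mx.
  - by move=> /le_anti E y ->; rewrite /= in_itv/= E mx.
  move=> /andP[kx xk] y; rewrite /= !in_itv/= => /andP[ky yk].
  have mk : (m <= k)%N.
    rewrite leqNgt; apply/negP => km.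
    by move: (lt_le_trans mx xk); rewrite ltNge pt_le// km.
  have kn : (k < n)%N.
    rewrite ltnNge; apply/negP => nk.
    by move: (le_lt_trans kx xn); rewrite ltNge pt_le// nk ltnW.
  by rewrite (le_lt_trans _ ky) ?(lt_le_trans yk)// pt_le// ?mk ?kn// ltnW.
have [Plo Phi] := Rng_ends (multimap_axioms F) a.
rewrite /Rng0; case Ea: class_of; try by rewrite /= in_itv/= => h Dx _; exact: open_case.
(* For [a] of class 2 the only point of [Rng0 a] lies in [P], hence in no open cell, so [b] is not
   of class 0. *)
move=> /= -> _ [//|]; have := DomP (multimap_axioms F) b.
rewrite /Dom0; case: class_of => [[k kr [-> ->]]|_|_].
- by rewrite /= in_itv/= => /(partition_point_gap kr) [].
- by move=> -> y ->.
- by move=> -> y ->.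
Qed.

Lemma MP a b x : Rng0 a x -> Dom0 b x -> M a b.
Proof.
by move=> Rx Dx; apply/asboolP; apply: Dom0_sub_Rng0 Rx (Dom0_sub Dx) _; right.
Qed.

Lemma MDom0 a b : M a b -> Dom0 b `<=` Rng0 a.
Proof. by move/asboolP. Qed.

(** The inclusion of [Dom0 b] in [Rng0 a] passes to closures; this lets closed graphs be followed
    along M-paths. *)
Lemma MDom a b : M a b -> Dom b `<=` Rng a.
Proof.
move=> /MDom0; have := @Dom_point b; have := DomP (multimap_axioms F) b.
move: (@Rng0_sub a) => hR.
rewrite /Dom0 /Dom; case Eb: class_of; last first.
- by move=> _ E H x /E-> //; apply/hR/H.
- by move=> _ E H x /E-> //; apply/hR/H.
move=> [k kr [-> ->]] _ H x.
have lk := pt_increasing (multimap_axioms F) kr.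
have H' y : pt F k < y < pt F k.+1 -> rlo a <= y <= rhi a.
  by move=> ky; have := hR y; rewrite /Rng /= in_itv; apply; apply: H; rewrite /= in_itv.
rewrite /Rng /= !in_itv/= => /andP[kx xk]; apply/andP; split.
  apply: le_trans kx; rewrite leNgt; apply/negP => k_lo.
  (* Otherwise the midpoint between the left end of the cell and [z] is in [Dom0 b] but below
     [rlo a]. *)
  pose z := Num.min (rlo a) (pt F k.+1).
  have kz : pt F k < z by rewrite lt_min k_lo lk.
  have zlo : z <= rlo a by rewrite ge_min lexx.
  have zk : z <= pt F k.+1 by rewrite ge_min lexx orbT.
  have [h1 h2] := midf_lt kz.
  have /H'/andP[] : pt F k < (pt F k + z) / 2 < pt F k.+1.
    by rewrite h1 (lt_le_trans h2).
  by rewrite leNgt (lt_le_trans h2).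
apply: (le_trans xk); rewrite leNgt; apply/negP => k_hi.
pose z := Num.max (rhi a) (pt F k).
have kz : z < pt F k.+1 by rewrite gt_max k_hi lk.
have zlo : rhi a <= z by rewrite le_max lexx.
have zk : pt F k <= z by rewrite le_max lexx orbT.
have [h1 h2] := midf_lt kz.
have /H'/andP[_] : pt F k < (z + pt F k.+1) / 2 < pt F k.+1.
  by rewrite h2 (le_lt_trans zk).
by rewrite leNgt (le_lt_trans zlo).
Qed.

(** [Gr a] exceeds [Gr0 a] only by the two ends of a branch (class 0) or of a vertical segment
    (class 1). *)
Lemma ends_partition_points a x y : Gr a (x, y) -> ~ Gr0 a (x, y) -> P x /\ P y.
Proof.
have [Pdl Pdh] := Dom_ends a; have [Prl Prh] := Rng_ends (multimap_axioms F) a.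
have itvP u v z : P u -> P v -> u <= z <= v -> ~ (u < z < v) -> P z.
  move=> Pu Pv /andP[]; rewrite le_eqVlt => /predU1P[<-//|uz].
  by rewrite le_eqVlt => /predU1P[->//|->]; rewrite uz => /(_ isT).
move=> Gxy nG; have [Ry xE] := Gr_inverse Gxy; have Dx := Gr_Dom Gxy.
have nR : ~ Rng0 a y by move=> /inverse_Gr0; rewrite -xE.
split; last first.
  move: Ry nR (Prl); rewrite /Rng /Rng0 /= in_itv/=; have := RngP (multimap_axioms F) a.
  case: class_of => [_|_|->]; [move=> h1 h2 _; exact: itvP h1 _ .. |].
  by move=> /le_anti ->.
case Ea : (class_of a); try by rewrite (Dom_point _ Dx) ?Ea.
move: Dx nG Gxy; rewrite /Dom /Gr0 /Gr /Dom0 Ea /= !in_itv/= => h1 h2 [_ h3].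
by apply: itvP h1 _ => // h4; apply: h2.
Qed.

Lemma Class2_partition_points a x y : class_of a = Class2 -> Gr a (x, y) ->
  P x /\ y = rlo a.
Proof.
move=> Ea Gxy; have [Ry _] := Gr_inverse Gxy.
split; first by rewrite (Dom_point _ (Gr_Dom Gxy)) ?Ea//; exact: (Dom_ends a).1.
move: Ry; rewrite /Rng /= in_itv/=; have := RngP (multimap_axioms F) a.
by rewrite Ea => -> /le_anti.
Qed.

Lemma Dom0_Class0 a x : Dom0 a x -> P x -> class_of a <> Class0.
Proof.
move=> + + Ea; rewrite /Dom0 Ea /= in_itv/=; have := DomP (multimap_axioms F) a.
by rewrite Ea => -[k kr [-> ->]] /(partition_point_gap kr).
Qed.

(** Class 0 is excluded because open cells contain no partition point, class 1 because [Rng a] meets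
    [P] only in its ends. *)
Lemma Gr0_Class2 a x y : Gr0 a (x, y) -> P x -> P y -> class_of a = Class2.
Proof.
move=> Gxy Px Py; have D0 := Dom0_Class0 (Gr0_Dom0 Gxy) Px.
case Ea : (class_of a) => //; have := Gr0_Rng0 Gxy.
have := RngP (multimap_axioms F) a; rewrite /Rng0 /Rng Ea => -[_ RP].
rewrite /= in_itv/= => /andP[h1 h2].
have : [set rlo a; rhi a] y by rewrite -RP; split => //=; rewrite in_itv/= !ltW.
by move=> [E|E]; [move: h1|move: h2]; rewrite E ltxx.
Qed.

(** Either [y] is off the closed interval [Rng a], or [g a y] differs from [x]; both persist nearby,
    the second by continuity of [g a]. *)
Lemma Gr_closed a x y : ~ Gr a (x, y) -> exists2 e, 0 < e &
  forall x' y', `|x' - x| < e -> `|y' - y| < e -> ~ Gr a (x', y').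
Proof.
move=> nG.
have away (u v z : R) : ~ (u <= z <= v) ->
    exists2 e, 0 < e & forall z', `|z' - z| < e -> ~ (u <= z' <= v).
  move/negP; rewrite negb_and -!ltNge => /orP[h|h].
    exists (u - z); first by rewrite subr_gt0.
    by move=> z'; rewrite ltr_norml => /andP[h1 h2] /andP[h3 h4]; lra.
  exists (z - v); first by rewrite subr_gt0.
  by move=> z'; rewrite ltr_norml => /andP[h1 h2] /andP[h3 h4]; lra.
have [Ry|/negP nR] := boolP (rlo a <= y <= rhi a); last first.
  have [e e0 eP] := away _ _ _ nR; exists e => // x' y' _ /eP nR' /Gr_inverse[].
  by rewrite /Rng /= in_itv.
have nE : g a y != x.
  by apply/eqP => E; apply: nG; rewrite -E; apply/inverse_Gr; rewrite /Rng/= in_itv.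
have e0 : 0 < `|g a y - x| / 2 by rewrite divr_gt0// normr_gt0 subr_eq0.
have /within_continuous_epsP/(_ y) := @inverse_continuous a.
rewrite /Rng /= in_itv/= => /(_ Ry _ e0)[d d0 dP].
exists (Num.min (`|g a y - x| / 2) d); first by rewrite lt_min e0.
move=> x' y'; rewrite !lt_min => /andP[h1 _] /andP[_ h2] /Gr_inverse[Ry' xE].
have := dP _ Ry' h2; rewrite -xE => h3.
have := ler_distD x' (g a y) x; rewrite leNgt => /negP; apply.
by rewrite [ltRHS](splitr `|g a y - x|) ltrD// distrC.
Qed.

End Symbols.

(** * Uniform radii and splicing of sequences *)

Lemma common_eps (R : realType) (I : finType) (Q : I -> R -> Prop) :
  (forall i, exists2 e, 0 < e & forall d, 0 < d -> d <= e -> Q i d) ->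
  exists2 e, 0 < e & forall i, Q i e.
Proof.
move=> /(_ _)/cid2-/all_sig2[e e0 eP].
(* The default 1 keeps the minimum positive when [I] is empty. *)
have m0 : 0 < \big[Num.min/1]_i e i by apply: lt_bigmin.
by exists (\big[Num.min/1]_i e i) => // i; apply: eP => //; exact: bigmin_le.
Qed.

Section Splicing.
Context {T : Type}.

Definition splice n (x y : nat -> T) k := if (k < n)%N then x k else y (k - n)%N.

Lemma spliceE n x y k : x n = y 0%N -> (k <= n)%N -> splice n x y k = x k.
Proof.
rewrite /splice leq_eqVlt => xy /predU1P[->|->//].
by rewrite ltnn subnn.
Qed.

Lemma splice_addE n x y k : splice n x y (n + k) = y k.
Proof. by rewrite /splice ltnNge leq_addr/= addKn. Qed.

End Splicing.

(** Since [x n = y 0], the step across the junction is still a step of [x]. [Q] will be membership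
    in the multigraph or the relation [M]. *)
Lemma splice_step (T U : Type) (n : nat) (x y : nat -> T) (s t : nat -> U)
    (Q : U -> T -> T -> Prop) : x n = y 0%N ->
  (forall k, (k < n)%N -> Q (s k) (x k) (x k.+1)) ->
  forall m, (forall k, (k < m)%N -> Q (t k) (y k) (y k.+1)) ->
  forall k, (k < n + m)%N ->
    Q (splice n s t k) (splice n x y k) (splice n x y k.+1).
Proof.
move=> xy Qx m Qy k km; have [kn|nk] := ltnP k n.
  by rewrite [splice n s t k]/splice kn (spliceE xy (ltnW kn)) spliceE//; exact: Qx.
rewrite -(subnKC nk) -addnS !splice_addE; apply: Qy.
by rewrite ltn_subLR.
Qed.

(** * Codes and orbit segments *)

Section Trajectories.
Context {R : realType} (F : Markov_multimap R).
Implicit Types (a b : symb F) (s t : nat -> symb F) (x y z : nat -> R).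

Notation g := (@inverse_branch R F).

Definition close n (e : R) x y := forall k, (k <= n)%N -> `|y k - x k| < e.

Lemma closeW n d e x y : d <= e -> close n d x y -> close n e x y.
Proof. by move=> de xy k /xy h; apply: lt_le_trans de. Qed.

Lemma close_open n e x y : close n e x y ->
  exists2 d, 0 < d & forall z, close n d y z -> close n e x z.
Proof.
move=> xy; pose d (i : 'I_n.+1) := e - `|y i - x i|.
have [|e' e'0 e'P] := @common_eps R _ (fun i c => c <= d i).
  move=> i; exists (d i); first by rewrite subr_gt0; apply: xy; rewrite -ltnS.
  by [].
exists e' => // z yz k kn; have := e'P (Ordinal (kn : (k < n.+1)%N)).
rewrite /d/= => h; have := yz k kn; have := ler_distD (y k) (z k) (x k); lra.
Qed.

Definition coded n s x := forall k, (k < n)%N -> Gr0 (s k) (x k, x k.+1).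

Definition weakly_coded n s x := forall k, (k < n)%N -> Gr (s k) (x k, x k.+1).

Lemma coded_weak n s x : coded n s x -> weakly_coded n s x.
Proof. by move=> sx k /sx/Gr0_sub. Qed.

(** This constrains the [n + 1] symbols up to [s n], while [coded n s x] involves only the [n]
    symbols before it; hence the shifts between [n] and [n.+1] below. *)
Definition Mpath n s := forall k, (k < n)%N -> M (s k) (s k.+1).

Lemma coded_Mpath n s x : coded n.+1 s x -> Mpath n s.
Proof.
move=> sx k kn; apply: MP (Gr0_Dom0 (sx k.+1 kn)).
exact: Gr0_Rng0 (sx k (ltnW kn)).
Qed.

Lemma multigraph01 p : multigraph F p -> (0 <= p.1 <= 1) /\ (0 <= p.2 <= 1).
Proof.
case: p => u v [a _] Ga; have [/Rng01 + _] := Gr_inverse Ga.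
by have /Dom01 := Gr_Dom Ga; rewrite /= !in_itv.
Qed.

Lemma weakly_coded_trajectory s x : (forall n, weakly_coded n s x) ->
  trajectories F x.
Proof.
move=> sx; have Gx k : multigraph F (x k, x k.+1).
  by exists (s k) => //; exact: sx k.+1 k (leqnn _).
split => // k; have [] := multigraph01 (Gx k).
by rewrite /= in_itv.
Qed.

(* [preorbit s n v k] is the k-th point of the orbit segment coded by
   [s 0, ..., s (n - 1)] whose n-th point is [v]. *)
Definition preorbit s n v k := inverse_word [seq s i | i <- iota k (n - k)] v.

Lemma preorbit_end s n v : preorbit s n v n = v.
Proof. by rewrite /preorbit subnn. Qed.

Lemma preorbit_step s n v k : (k < n)%N ->
  preorbit s n v k = g (s k) (preorbit s n v k.+1).
Proof. by move=> kn; rewrite /preorbit -subnSK. Qed.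

Lemma weakly_coded_preorbit n s x k : weakly_coded n s x -> (k <= n)%N ->
  x k = preorbit s n (x n) k.
Proof.
(* Backward induction, with [j] the distance to the end [n]. *)
move=> sx kn; rewrite -(subKn kn); move: (n - k)%N (leq_subr k n) => j {k kn}.
elim: j => [|j IH] jn; first by rewrite subn0 preorbit_end.
have kn : (n - j.+1 < n)%N by rewrite ltn_subrL (leq_trans _ jn).
have [_ ->] := Gr_inverse (sx _ kn).
by rewrite preorbit_step// subnSK// IH// ltnW.
Qed.

(** Going backwards, each point lies in [Dom0] of its symbol, which [M] places inside [Rng0] of the
    preceding one. *)
Lemma preorbit_coded n s v : Mpath n s -> Rng0 (s n) v ->
  coded n.+1 s (preorbit s n.+1 v).
Proof.
move=> sM Rv k; rewrite ltnS => kn; rewrite -(subKn kn).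
move: (n - k)%N (leq_subr k n) => j {k kn}.
elim: j => [|j IH] jn.
  by rewrite subn0 preorbit_step// preorbit_end; exact: inverse_Gr0.
rewrite preorbit_step ?ltnS ?leq_subr//; apply: inverse_Gr0.
have := IH (ltnW jn); rewrite -(subnSK jn) => /Gr0_Dom0.
by apply/MDom0/sM; rewrite ltn_subrL (leq_trans _ jn).
Qed.

Lemma preorbit_weakly_coded n s v : Mpath n s -> Rng (s n) v ->
  weakly_coded n.+1 s (preorbit s n.+1 v).
Proof.
move=> sM Rv k; rewrite ltnS => kn; rewrite -(subKn kn).
move: (n - k)%N (leq_subr k n) => j {k kn}.
elim: j => [|j IH] jn.
  by rewrite subn0 preorbit_step// preorbit_end; exact: inverse_Gr.
rewrite preorbit_step ?ltnS ?leq_subr//; apply: inverse_Gr.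
have := IH (ltnW jn); rewrite -(subnSK jn) => /Gr_Dom.
by apply/MDom/sM; rewrite ltn_subrL (leq_trans _ jn).
Qed.

Lemma preorbit_continuous n s k : Mpath n s -> (k <= n.+1)%N ->
  {within Rng (s n), continuous (fun v => preorbit s n.+1 v k)}.
Proof.
move=> sM kn; rewrite -(subKn kn).
move: (n.+1 - k)%N (leq_subr k n.+1) => j {k kn}.
elim: j => [|j IH] jn.
  rewrite subn0; apply/within_continuous_epsP => v Rv e e0.
  by exists e => // w _; rewrite !preorbit_end.
have {}IH := IH (ltnW jn).
have kn : (n.+1 - j.+1 < n.+1)%N by rewrite ltn_subrL.
apply/within_continuous_epsP => v Rv e e0.
have RP w : Rng (s n) w ->
    Rng (s (n.+1 - j.+1)%N) (preorbit s n.+1 w (n.+1 - j)).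
  move=> Rw; have [] := Gr_inverse (preorbit_weakly_coded sM Rw kn).
  by rewrite subnSK.
have /within_continuous_epsP/(_ _ (RP _ Rv) _ e0)[d d0 dP] :=
  @inverse_continuous R F (s (n.+1 - j.+1)%N).
have /within_continuous_epsP/(_ _ Rv _ d0)[c c0 cP] := IH.
exists c => // w Rw wv.
rewrite (preorbit_step _ v kn) (preorbit_step _ w kn) subnSK//; apply: dP; first exact: RP.
exact: cP.
Qed.

(** Each coordinate is a continuous function of the next, so the last one controls all the
    others. *)
Lemma weakly_coded_close n s x e : weakly_coded n s x -> 0 < e ->
  exists2 d, 0 < d & forall y, weakly_coded n s y -> `|y n - x n| < d ->
    close n e x y.
Proof.
elim: n => [|n IH] sx e0.
  by exists e => // y _ yx k; rewrite leqn0 => /eqP ->.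
have [d d0 dP] := IH (fun k kn => sx k (ltnW kn)) e0.
have [Rx xE] := Gr_inverse (sx n (leqnn _)).
have /within_continuous_epsP/(_ _ Rx _ d0)[c c0 cP] := @inverse_continuous R F (s n).
exists (Num.min c e); first by rewrite lt_min c0.
move=> y sy; rewrite lt_min => /andP[yc ye] k; rewrite leq_eqVlt => /predU1P[->//|kn].
apply: dP => //; first by move=> i ni; exact: sy i (ltnW ni).
have [Ry yE] := Gr_inverse (sy n (leqnn _)).
by rewrite xE yE; exact: cP.
Qed.

(** * Existence and uniqueness of codes *)

Context (F_proper : properly_parametrized F).

Lemma multigraph_Gr0 p : multigraph F p -> exists a, Gr0 a p.
Proof. by case: F_proper => <- _ _ [a _ Ga]; exists a. Qed.

Lemma Gr0_inj a b p : Gr0 a p -> Gr0 b p -> a = b.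
Proof.
by case: F_proper => _ /(_ a b I I) inj _ Ga Gb; apply: inj; exists p.
Qed.

Lemma Rng0_nonempty a : Rng0 a !=set0.
Proof.
by have [_ _ /(_ a I)[[u v] /Gr0_Rng0 Rv]] := F_proper; exists v.
Qed.

Lemma Mpath_coded n s : Mpath n s ->
  exists x, coded n.+1 s x.
Proof.
move=> sM; have [v Rv] := Rng0_nonempty (s n).
by exists (preorbit s n.+1 v); exact: preorbit_coded.
Qed.

Lemma coded_inj n s t x : coded n s x -> coded n t x ->
  forall k, (k < n)%N -> s k = t k.
Proof. by move=> sx tx k kn; apply: Gr0_inj (sx k kn) (tx k kn). Qed.

Lemma trajectory_coded x : trajectories F x -> exists s, forall n, coded n s x.
Proof.
move=> [_ xF]; have /choice[s sP] : forall k, exists a, Gr0 a (x k, x k.+1).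
  by move=> k; exact: multigraph_Gr0 (xF k).
by exists s => n k _; exact: sP.
Qed.

Lemma trajectory_start u : 0 <= u <= 1 -> exists2 x, trajectories F x & x 0%N = u.
Proof.
move=> u01; have nextP v : exists w, 0 <= v <= 1 -> multigraph F (v, w).
  have [v01|] := boolP (0 <= v <= 1); last by exists 0.
  have : (\bigcup_a Dom (a : symb F)) v.
    by rewrite (Dom_cover (multimap_axioms F)) /= in_itv.
  case=> a _ Dv; have Rlo : Rng a (rlo a).
    by rewrite /Rng /= in_itv/= lexx rlo_le_rhi.
  case Ea : (class_of a).
  - by exists (branch a v) => _; exists a => //; rewrite /Gr Ea.
  - by exists (rlo a) => _; exists a => //; rewrite /Gr Ea.
  - by exists (rlo a) => _; exists a => //; rewrite /Gr Ea.
have /choice[next {}nextP] := nextP.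
have x01 k : 0 <= iter k next u <= 1.
  by elim: k => //= k /nextP/multigraph01[].
exists (fun k => iter k next u) => //; split => k.
  by rewrite /= in_itv/=; exact: x01.
exact: nextP.
Qed.

Lemma segment_extend n x : 0 <= x n <= 1 ->
  (forall k, (k < n)%N -> multigraph F (x k, x k.+1)) ->
  exists2 y, trajectories F y & forall k, (k <= n)%N -> y k = x k.
Proof.
move=> /trajectory_start[z [_ zF] /esym xz] xF.
exists (splice n x z); last by move=> k; exact: spliceE.
have yF k : multigraph F (splice n x z k, splice n x z k.+1).
  apply: (@splice_step _ unit n x z (fun=> tt) (fun=> tt)
    (fun _ v w => multigraph F (v, w)) xz _ k.+1) => //.
  by rewrite addnS ltnS leq_addl.
by split=> // k; have [] := multigraph01 (yF k); rewrite /= in_itv.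
Qed.

Lemma coded_extend n s x : (0 < n)%N -> coded n s x ->
  exists2 y, trajectories F y & forall k, (k <= n)%N -> y k = x k.
Proof.
move=> n0 sx; have xF k : (k < n)%N -> multigraph F (x k, x k.+1).
  by move=> kn; exists (s k) => //; apply: Gr0_sub; exact: sx.
apply: segment_extend => //.
by case: n n0 {sx} xF => // n _ /(_ n (leqnn _))/multigraph01[].
Qed.

(** * Local constancy of codes *)

(** A closed graph [Gr b] missing [(u, v)] stays away from it. If [(u, v)] is in [Gr b] but not in
    [Gr0 b], both coordinates are in [P], so [a] is of class 2; [b] is not, as both graphs agree for
    class 2. *)
Lemma code_near a u v : Gr0 a (u, v) -> exists2 e, 0 < e &
  forall b u' v', `|u' - u| < e -> `|v' - v| < e -> Gr0 b (u', v') ->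
    b = a \/ (class_of a = Class2 /\ class_of b <> Class2).
Proof.
move=> Ga; have [|e e0 eP] := @common_eps R (symb F) (fun b e =>
    forall u' v', `|u' - u| < e -> `|v' - v| < e -> Gr0 b (u', v') ->
    b = a \/ (class_of a = Class2 /\ class_of b <> Class2)); last first.
  by exists e.
move=> b; have [->|ba] := eqVneq b a; first by exists 1 => //; left.
have nG0 : ~ Gr0 b (u, v) by move=> /(Gr0_inj Ga)/esym/eqP; rewrite (negbTE ba).
have [Gb|nGb] := pselect (Gr b (u, v)); last first.
  have [e e0 eP] := Gr_closed nGb; exists e => // d d0 de u' v' uu vv Gb'.
  case: (eP u' v'); rewrite ?(lt_le_trans _ de)//.
  exact: Gr0_sub.
have [Pu Pv] := ends_partition_points Gb nG0.
exists 1 => // d d0 d1 u' v' _ _ _; right; split.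
  exact: Gr0_Class2 Ga Pu Pv.
move=> Eb; apply: nG0; move: Gb; rewrite /Gr /Gr0 Eb /Dom0 /Rng0 Eb.
move=> Gb; have /= [Db Rb] := Gb; split => /=.
  by apply: Dom_point Db; rewrite Eb.
have := @Class2_partition_points R F b u v Eb.
by rewrite /Gr Eb => /(_ Gb)[].
Qed.

(** The cylinder of [s] is a neighbourhood of [x]: the openness in the definition of essential
    words, at one point. *)
Definition locally_coded n s x := exists2 e, 0 < e &
  forall y, trajectories F y -> close n e x y -> coded n s y.

Definition class2b a := if class_of a is Class2 then true else false.

Lemma class2P a : reflect (class_of a = Class2) (class2b a).
Proof. by rewrite /class2b; case: class_of; constructor. Qed.

Lemma code_near_segment n s x : coded n s x -> exists2 e, 0 < e &
  forall t y, coded n t y -> close n e x y -> forall k, (k < n)%N ->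
    t k = s k \/ (class2b (s k) /\ ~~ class2b (t k)).
Proof.
move=> sx; have [|e e0 eP] := @common_eps R 'I_n (fun k e =>
   forall b u v, `|u - x k| < e -> `|v - x k.+1| < e -> Gr0 b (u, v) ->
    b = s k \/ (class2b (s k) /\ ~~ class2b b)).
  move=> k; have [e e0 eP] := code_near (sx k (ltn_ord k)).
  exists e => // d d0 de b u v uu vv Gb.
  case: (eP b u v _ _ Gb); rewrite ?(lt_le_trans _ de)//; first by left.
  by move=> [/class2P h1 /class2P h2]; right.
exists e => // t y ty xy k kn; apply: (eP (Ordinal kn) _ (y k) (y k.+1)) (ty k kn).
  exact: xy k (ltnW kn).
exact: xy k.+1 kn.
Qed.

(** The point of [W] is chosen with the fewest symbols of class 2 before time [n]. Nearby codes
    could only trade such symbols for others, which minimality forbids. *)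
Lemma exists_locally_coded n (W : set (nat -> R)) :
  (forall x, trajectories F x -> W x -> exists2 e, 0 < e &
    forall y, trajectories F y -> close n e x y -> W y) ->
  forall x, trajectories F x -> W x ->
  exists y s, [/\ trajectories F y, W y, forall m, coded m s y & locally_coded n s y].
Proof.
move=> Wopen x Fx Wx.
pose N s := (\sum_(k < n) class2b (s k))%N.
pose Q m := exists y s, [/\ trajectories F y, W y, forall m, coded m s y & N s = m].
have exQ : exists m, `[< Q m >].
  have [s sx] := trajectory_coded Fx.
  by exists (N s); apply/asboolP; exists x, s.
have [m /asboolP[y [s [Fy Wy sy Nm]]] mmin] := ex_minnP exQ.
exists y, s; split => //.
have [d d0 dP] := Wopen y Fy Wy.
have [e e0 eP] := code_near_segment (sy n).
exists (Num.min d e); first by rewrite lt_min d0.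
move=> z Fz yz; have [t tz] := trajectory_coded Fz.
have {}eP := eP t z (tz n) (closeW _ yz); rewrite ge_min lexx orbT in eP.
have {}eP := eP isT.
have Wz : W z by apply: dP => //; apply: closeW yz; rewrite ge_min lexx.
have /mmin Nt : `[< Q (N t) >] by apply/asboolP; exists z, t.
have le k : (k < n)%N -> (class2b (t k) <= class2b (s k))%N.
  by move=> /eP[->//|[-> _]]; case: class2b.
have eqN k : (k < n)%N -> class2b (s k) -> class2b (t k).
  move=> kn sk; apply: contraT => /negbTE tk.
  (* Losing class 2 at the position [k] makes [N t] strictly smaller than [N s]. *)
  move: Nt; rewrite leqNgt -Nm /N => /negP; case.
  rewrite (bigD1 (Ordinal kn))//= [ltnRHS](bigD1 (Ordinal kn))//= sk tk.
  by rewrite add0n add1n ltnS; apply: leq_sum => i _; exact: le.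
move=> k kn; have [<-|[h1 h2]] := eP k kn; first exact: tz kn.
by move: h2; rewrite eqN.
Qed.

(* The coordinates up to the last symbol outside class 0 are common to all
   points with the code s, so near y they can be combined with the later
   coordinates of x. *)
Lemma locally_coded_transfer n s x y : trajectories F x -> trajectories F y ->
  coded n s x -> coded n s y -> locally_coded n s x -> locally_coded n s y.
Proof.
move=> Fx Fy sx sy [e e0 eP].
have [d d0 dP] := code_near_segment sy.
(* Induction on [j], a position from which all symbols before [n] are of class 0. *)
suff H j : (j <= n)%N ->
    (forall k, (j <= k < n)%N -> class_of (s k) = Class0) -> locally_coded n s y.
  by apply: (H n) => // k; case: ltnP; rewrite ?andbF// => h /andP[]; lia.
elim: j => [|j IH] jn C0.
  exists d => // z Fz yz k kn; have [t tz] := trajectory_coded Fz.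
  have [<-|[/class2P]] := dP t z (tz n) yz k kn; first exact: tz kn.
  by rewrite C0.
have [E|nE] := pselect (class_of (s j) = Class0).
  apply: IH; first exact: ltnW.
  move=> k /andP[]; rewrite leq_eqVlt => /predU1P[<-//|jk kn].
  by apply: C0; rewrite jk.
(* Outside class 0 the domain is a single point, so [x j = y j], and inverse branches determine the
   earlier coordinates. *)
have xy k : (k <= j)%N -> x k = y k.
  have xyj : x j = y j.
    rewrite (Dom_point nE (Gr_Dom (Gr0_sub (sx j jn)))).
    by rewrite (Dom_point nE (Gr_Dom (Gr0_sub (sy j jn)))).
  move=> kj; have sub z : coded n s z -> weakly_coded j s z.
    by move=> sz i ij; apply/Gr0_sub/sz/(ltn_trans ij).
  rewrite (weakly_coded_preorbit (sub _ sx) kj) xyj -weakly_coded_preorbit//.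
  exact: sub.
(* A symbol of class 2 leads to a point of [P], where no class 0 symbol can follow. It is therefore
   the last one, and [x] and [y] agree up to time [n]. *)
case Ej : (class_of (s j)) => //; last first.
  have [Px xjE] := Class2_partition_points Ej (Gr0_sub (sx j jn)).
  have [_ yjE] := Class2_partition_points Ej (Gr0_sub (sy j jn)).
  have nj : n = j.+1.
    apply/eqP; rewrite eqn_leq jn andbT leqNgt; apply/negP => jn'.
    have := Dom0_Class0 (Gr0_Dom0 (sx _ jn')).
    rewrite xjE => /(_ (Rng_ends (multimap_axioms F) _).1); apply.
    by apply: C0; rewrite leqnn.
  exists e => // z Fz yz; apply: eP => // k kn; suff -> : x k = y k by exact: yz.
  move: kn; rewrite nj leq_eqVlt => /predU1P[->|/xy//].
  by rewrite xjE yjE.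
exists (Num.min e d); first by rewrite lt_min e0.
move=> z Fz yz; have [t tz] := trajectory_coded Fz.
have {}dP := dP t z (tz n) (closeW _ yz); rewrite ge_min lexx orbT in dP.
have {}dP := dP isT.
have ts k : (j <= k < n)%N -> t k = s k.
  move=> /andP[jk kn]; have [//|[/class2P]] := dP k kn.
  move: jk; rewrite leq_eqVlt => /predU1P[<-|jk]; first by rewrite Ej.
  by rewrite C0 ?jk.
have zxj : z j = x j.
  have := tz n j jn; rewrite ts ?leqnn// => Gz.
  rewrite (Dom_point nE (Gr_Dom (Gr0_sub Gz))).
  by rewrite (Dom_point nE (Gr_Dom (Gr0_sub (sx j jn)))).
(* A trajectory since [z j = x j], and close to [x] because [x] and [y] agree up to [j]; so [w] has
   the code [s], and hence so does [z] before [j]. *)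
pose w k := if (k <= j)%N then z k else x k.
have Fw : trajectories F w.
  have [[z01 zF] [x01 xF]] := (Fz, Fx).
  split => k; rewrite /w; first by case: ifP.
  case: (ltngtP k j) => // ->; rewrite zxj; exact: xF.
have sw : coded n s w.
  apply: eP => // k kn; rewrite /w; case: ifP => kj; last by rewrite subrr normr0.
  by rewrite xy//; apply: lt_le_trans (yz k kn) _; rewrite ge_min lexx.
move=> k kn; have [kj|jk] := ltnP k j.
  by have := sw k kn; rewrite /w kj ltnW.
by rewrite -ts ?jk//; exact: tz kn.
Qed.

End Trajectories.

(** * Topology of the trajectory space *)

Section Topology.
Context {R : realType} (F : Markov_multimap R).

Lemma eval_continuous (I : eqType) (A : set {ptws I -> R}) (i : I) :
  continuous (fun x : set_type A => set_val x i).
Proof.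
move=> x; apply: (@continuous_comp _ _ _
  (set_val : set_type A -> {ptws I -> R}) (fun z : {ptws I -> R} => z i)).
  exact: initial_continuous.
exact: (@proj_continuous I (fun=> R) i).
Qed.

Lemma nbhs_eval (I : eqType) (A : set {ptws I -> R}) (J : finType) (j : J -> I)
    (x : set_type A) (e : R) : 0 < e ->
  nbhs x [set y | forall k, `|set_val y (j k) - set_val x (j k)| < e].
Proof.
move=> e0; apply: (@filter_forall _ J
  (fun k y => `|set_val y (j k) - set_val x (j k)| < e) _ (nbhs_filter x)) => k.
have /cvgrPdist_lt/(_ _ e0) := @eval_continuous I A (j k) x.
by apply: filterS => y /=; rewrite distrC.
Qed.

Lemma cvg_initial (S : choiceType) (V : topologicalType) (f : S -> V)
    (G : set_system S) (x : S) : Filter G ->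
  f @ G --> f x -> G --> (x : initial_topology f).
Proof.
move=> GF Gx U; rewrite nbhsE => -[W [[C oC CW] Wx] WU].
have : nbhs (f x) C by apply: open_nbhs_nbhs; split => //; rewrite -CW in Wx.
move=> /Gx fGC; apply: (@filterS _ G GF (f @^-1` C)) => // y Cy.
by apply: WU; rewrite -CW.
Qed.

Lemma cvg_eval (I : eqType) (A : set {ptws I -> R}) (G : set_system (set_type A))
    (x : set_type A) : Filter G ->
  (forall k, (fun y => set_val y k) @ G --> set_val x k) -> G --> x.
Proof.
move=> GF Gx; apply: (@cvg_initial _ {ptws I -> R} set_val G x GF).
apply/cvg_sup => k.
apply: (@cvg_initial _ R (fun y : I -> R => y k) (set_val @ G)).
exact: Gx.
Qed.

Lemma nbhs_close (A : set {ptws nat -> R}) (x : set_type A) (U : set (set_type A)) :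
  nbhs x U <-> exists n, exists2 e, 0 < e &
    forall y, close n e (set_val x) (set_val y) -> U y.
Proof.
split=> [|[n [e e0 eU]]]; last first.
  have := @nbhs_eval _ A 'I_n.+1 (@nat_of_ord n.+1) x e e0.
  apply: filterS => y yP; apply: eU => k; rewrite -ltnS => kn.
  exact: yP (Ordinal kn).
move=> Ux.
(* The boxes [B n] generate a filter converging to [x] in every coordinate, hence in the space, so
   one of them lies in [U]. *)
pose B n := [set y : set_type A | close n n.+1%:R^-1 (set_val x) (set_val y)].
pose G := filter_from [set: nat] B.
have GF : Filter G.
  apply: filter_from_filter; first by exists 0%N.
  move=> i j _ _; exists (maxn i j) => // y yB; split => k ki.
    apply: lt_le_trans (yB k _) _; first by rewrite leq_max ki.
    by rewrite lef_pV2 ?posrE// ler_nat ltnS leq_maxl.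
  apply: lt_le_trans (yB k _) _; first by rewrite leq_max ki orbT.
  by rewrite lef_pV2 ?posrE// ler_nat ltnS leq_maxr.
have /(_ _ Ux)[n _ nP] : G --> x.
  apply: cvg_eval => k; apply/cvgrPdist_lt => e e0.
  have [m me] : exists m, m.+1%:R^-1 < e.
    have [m _ /(_ m (leqnn m))] := near_infty_natSinv_lt (PosNum e0).
    by exists m.
  exists (maxn k m) => // y /= /(_ k); rewrite leq_maxl distrC => /(_ isT) yk.
  apply: lt_trans yk _; apply: le_lt_trans me.
  by rewrite lef_pV2 ?posrE// ler_nat ltnS leq_maxr.
by exists n, n.+1%:R^-1; rewrite ?invr_gt0.
Qed.

Lemma open_close (A : set {ptws nat -> R}) (U : set (set_type A)) :
  open U <-> forall x, U x -> exists n, exists2 e, 0 < e &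
    forall y, close n e (set_val x) (set_val y) -> U y.
Proof.
rewrite openE; split => H x /H /=; first by move/nbhs_close.
by move=> /nbhs_close.
Qed.

Implicit Types (a b : symb F) (s t : nat -> symb F) (x y z : nat -> R).

Definition to_X x (Fx : trajectories F x) : X F := exist _ x (mem_set Fx).

Lemma set_valX (x : X F) : trajectories F (set_val x).
Proof. exact: set_mem (valP x). Qed.

Lemma iter_T n (x : X F) k : set_val (iter n (@T R F) x) k = set_val x (k + n)%N.
Proof.
elim: n k => [|n IH] k; first by rewrite addn0.
by rewrite -addSnnS -IH.
Qed.

Lemma X_inj (x y : X F) : (forall k, set_val x k = set_val y k) -> x = y.
Proof. by move=> xy; apply: val_inj; apply/funext => k; exact: xy. Qed.

Lemma open_T_preimage n (V : set (X F)) : open V -> open (iter n (@T R F) @^-1` V).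
Proof.
rewrite !open_close => oV x /= /oV[m [e e0 eV]].
exists (m + n)%N, e => // y xy; apply: eV => k km; rewrite !iter_T.
by apply: xy; rewrite leq_add2r.
Qed.

(** If [V] had no preimage, a point [v] of [V] would differ from [T v]. Going from a neighbourhood
    of [T v] to a disjoint one of [v] inside [V] takes positive time, and the point before arrival
    is a preimage. *)
Lemma T_preimage_nonempty n (V : set (X F)) : topologically_transitive (@T R F) ->
  open V -> V !=set0 -> iter n (@T R F) @^-1` V !=set0.
Proof.
move=> tr; elim: n V => [|n IH] V oV [v Vv]; first by exists v.
suff [w Vw] : (@T R F) @^-1` V !=set0.
  have := IH _ (@open_T_preimage 1%N _ oV); case; first by exists w.
  by move=> u Vu; exists u.
have [//|nV] := pselect ((@T R F) @^-1` V !=set0).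
have vT : v <> T v by move=> E; apply: nV; exists v; rewrite /= -E.
have [k vk] : exists k, set_val v k != set_val (T v) k.
  apply/not_existsP => H; apply: vT; apply: X_inj => k.
  by apply/eqP/negPn/negP; exact: H.
(* Half the distance makes [U v] and [U (T v)] disjoint. *)
pose e := `|set_val v k - set_val (T v) k| / 2.
have e0 : 0 < e by rewrite divr_gt0// normr_gt0 subr_eq0.
pose U (u : X F) := [set y : X F | `|set_val y k - set_val u k| < e].
have oU u : open (U u).
  apply/open_close => y yU; exists k, (e - `|set_val y k - set_val u k|).
    by rewrite subr_gt0.
  move=> z /(_ k (leqnn k)) /= zy; rewrite /U /=.
  by have := ler_distD (set_val y k) (set_val z k) (set_val u k); lra.
have UU u : U u u by rewrite /U /= subrr normr0.
have [| |[|m] [_ [[z Uz <-] [Vz Uvz]]]] :=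
    tr (U (T v)) (V `&` U v) (oU _) (openI oV (oU _)).
- by exists (T v).
- by exists v.
- exfalso; move: Uz Uvz; rewrite /U /= => h1 h2.
  have := ler_distD (set_val z k) (set_val v k) (set_val (T v) k).
  by rewrite [X in _ <= X + _]distrC; move: h1 h2; rewrite /e; lra.
- by exfalso; apply: nV; exists (iter m (@T R F) z).
Qed.

Lemma set_val_cylinder (n : nat) (u : n.-tuple (symb F)) (x : X_ F n.+1) s :
    (forall k : 'I_n, tnth u k = s k) ->
  (forall k : 'I_n, Gr0 (tnth u k) (set_val x (widen_ord (leqnSn n) k),
      set_val x (lift ord0 k))) <-> coded n s (fun k => set_val x (inord k)).
Proof.
move=> us; split=> [H k kn|H k].
  have := H (Ordinal kn); rewrite us; congr (Gr0 _ (set_val x _, set_val x _));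
    by apply: val_inj; rewrite /= ?inordK ?ltnS ?(ltnW kn)// /bump.
have := H k (ltn_ord k); rewrite us; congr (Gr0 _ (set_val x _, set_val x _));
  by apply: val_inj; rewrite /= ?inordK ?ltnS ?(ltn_ord k)// ?(ltnW (ltn_ord k))// /bump.
Qed.

Lemma truncate_subproof n x : trajectories F x ->
  finite_trajectories F (fun i : 'I_n => x i).
Proof. by move=> [x01 xF]; split => [i|i j ->]; [exact: x01|exact: xF]. Qed.

Definition truncate n x (Fx : trajectories F x) : X_ F n :=
  exist _ (fun i : 'I_n => x i) (mem_set (@truncate_subproof n x Fx)).

Context (F_proper : properly_parametrized F).

Lemma finite_trajectory_extend n (x : X_ F n.+1) :
  exists2 y, trajectories F y & forall k : 'I_n.+1, y k = set_val x k.
Proof.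
have [x01 xF] : finite_trajectories F (set_val x) := set_mem (valP x).
have [||y Fy yx] := @segment_extend R F n (fun k => set_val x (inord k)).
- by have := x01 (inord n); rewrite /= in_itv.
- by move=> k kn; apply: xF; rewrite !inordK// ltnS ltnW.
- by exists y => // k; rewrite yx ?inord_val// -ltnS.
Qed.

(** Points of [X_ n.+1] extend to trajectories, and local coding transfers from [x] to every point
    of the cylinder, which is therefore open. *)
Lemma locally_coded_essential n s x : (forall m, coded m s x) -> locally_coded n s x ->
  forall k, (k < n)%N -> essential_symbols (s k).
Proof.
move=> sx loc k kn; exists n, [tuple s i | i < n]; split; last first.
  by apply/tnthP; exists (Ordinal kn); rewrite tnth_mktuple.
have Fx : trajectories F x.
  by apply: (@weakly_coded_trajectory _ _ s) => m; exact/coded_weak.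
split.
  exists s; first by move=> m; exact: (coded_Mpath (sx m.+2)).
  by exists 0%N => i; rewrite tnth_mktuple.
have us (i : 'I_n) : tnth [tuple s i | i < n] i = s i by rewrite tnth_mktuple.
rewrite openE => y /= /(set_val_cylinder _ us) sy.
have [y' Fy' yy'] := finite_trajectory_extend y.
have sy' : coded n s y'.
  move=> i ni; have := sy i ni.
  by rewrite -!yy' !inordK// ltnS ltnW.
have [e e0 eP] := locally_coded_transfer F_proper Fx Fy' (sx n) sy' loc.
have := @nbhs_eval _ _ 'I_n.+1 id y e e0; apply: filterS => z zy.
apply/(set_val_cylinder _ us).
have [z' Fz' zz'] := finite_trajectory_extend z.
move=> i ni; rewrite -!zz' !inordK ?ltnS// 1?ltnW//.
apply: eP => // j jn; have := zy (Ordinal (jn : (j < n.+1)%N)).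
by rewrite -zz' -yy'.
Qed.

(** Openness in [X_ n.+1] is pulled back to [X] along the continuous map [truncate]. *)
Lemma essential_cylinder a : essential_symbols a ->
  exists n s, [/\ open [set x : X F | coded n s (set_val x)],
    [set x : X F | coded n s (set_val x)] !=set0 &
    exists2 i, (i < n)%N & s i = a].
Proof.
move=> [n [u [[[s sM [k us]] uo] /tnthP[i ai]]]].
have {}us (j : 'I_n) : tnth u j = s (k + j)%N by exact: us.
exists n, (fun j => s (k + j)%N); split.
- rewrite openE => x /= sx.
  pose Fx := set_valX x.
  have : nbhs (truncate n.+1 Fx) [set y : X_ F n.+1 | forall k : 'I_n,
      Gr0 (tnth u k) (set_val y (widen_ord (leqnSn n) k), set_val y (lift ord0 k))].
    apply: open_nbhs_nbhs; split => //= j; rewrite us.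
    by have := sx j (ltn_ord j).
  pose tr (y : X F) := truncate n.+1 (set_valX y).
  have trc : tr @ x --> tr x.
    have FF : Filter (tr @ x) := fmap_filter tr (nbhs_filter x).
    apply: cvg_eval => j; exact: (@eval_continuous _ _ (j : nat) x).
  move=> /trc; rewrite /interior; near_simpl; apply: filterS => y /= yP j jn.
  by have := yP (Ordinal jn); rewrite us.
- have : Mpath n (fun j => s (k + j)%N) by move=> j _; rewrite addnS; exact: sM.
  move=> /(Mpath_coded F_proper)[x sx].
  have [y Fy yx] := coded_extend (ltn0Sn n) sx.
  exists (to_X Fy) => j jn /=; have := sx j (ltnW jn).
  by rewrite -(yx j (leqW (ltnW jn))) -(yx j.+1 (ltnW jn)).
- by exists (i : nat); rewrite ?ltn_ord -?us.
Qed.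

End Topology.

(** * Words, paths and irreducible components *)

Lemma last_map_iota (T : Type) (s : nat -> T) k n :
  last (s k) [seq s i | i <- iota k.+1 n] = s (k + n)%N.
Proof.
rewrite last_map; congr s.
by elim: n k => [|n IH] k /=; rewrite ?addn0// IH addSnnS.
Qed.

Section Symbolic_dynamics.
Context {R : realType} (F : Markov_multimap R).
Implicit Types (a b c : symb F) (C : set (symb F)) (s t : nat -> symb F).

Lemma language_starts_ends (Z : set (nat -> symb F)) a b :
  (exists2 w, language Z w & starts_ends a b w) <->
  exists s k n, [/\ Z s, s k = a & s (k + n)%N = b].
Proof.
split=> [[w' Zw [w [ww <-]]]|[s [k [n [Zs <- <-]]]]].
  move: Zw; rewrite ww => -[s Zs [k ws]]; exists s, k, (size w); split => //.
    by have := ws ord0; rewrite (tnth_nth a) /= addn0.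
  have := ws ord_max; rewrite (tnth_nth a) /= => <-.
  by rewrite (last_nth a).
exists [seq s i | i <- iota k n.+1].
  exists s => //; exists k => i; rewrite (tnth_nth (s k)).
  have i_n : (i < n.+1)%N.
    by have := ltn_ord i; rewrite [X in (_ < X)%N]size_map size_iota.
  by rewrite (nth_map 0%N) ?size_iota// nth_iota.
exists [seq s i | i <- iota k.+1 n]; split => //.
exact: last_map_iota.
Qed.

(** Paths have positive length, so [reach a a] means that [a] lies on a cycle. *)
Definition reach a b := exists s n,
  [/\ (0 < n)%N, s 0%N = a, s n = b & Mpath n s].

Lemma reach_trans b a c : reach a b -> reach b c -> reach a c.
Proof.
move=> [s [n [n0 s0 sn sM]]] [t [m [m0 t0 tm tM]]].
have st : s n = t 0%N by rewrite sn t0.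
exists (splice n s t), (n + m)%N; split.
- by rewrite addn_gt0 n0.
- by rewrite spliceE.
- by rewrite splice_addE.
- exact: (@splice_step _ unit n s t (fun=> tt) (fun=> tt) (fun _ a b => M a b)).
Qed.

Lemma Mpath_reach s n i j : Mpath n s -> (i < j <= n)%N -> reach (s i) (s j).
Proof.
move=> sM /andP[ij jn]; exists (fun k => s (i + k)%N), (j - i)%N; split.
- by rewrite subn_gt0.
- by rewrite addn0.
- by rewrite subnKC// ltnW.
- by move=> k kij; rewrite addnS; apply: sM; lia.
Qed.

Lemma Sigma_M_Mpath s n : Sigma_M s -> Mpath n s.
Proof. by move=> sM k _; exact: sM. Qed.

(** The language consists of words of infinite sequences, so a finite path in [C] must be continued
    inside [C]. *)
Lemma Mpath_extend C s n : (forall c, C c -> exists2 d, C d & M c d) ->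
  (forall k, (k <= n)%N -> C (s k)) -> Mpath n s ->
  exists2 t, Sigma_on C t & forall k, (k <= n)%N -> t k = s k.
Proof.
move=> Cnext Cs sM.
have /choice[next nextP] : forall c, exists d, C c -> C d /\ M c d.
  move=> c; have [/Cnext[d Cd cd]|nC] := pselect (C c); first by exists d.
  by exists c.
pose t k := iter k next (s n).
have Ct k : C (t k) by elim: k => [|k /nextP[]//]; exact: Cs.
exists (splice n s t); last by move=> k; exact: spliceE.
split=> k.
  apply: (@splice_step _ unit n s t (fun=> tt) (fun=> tt)
    (fun _ a b => M a b) _ _ k.+1) => //; last by rewrite addnS ltnS leq_addl.
  by move=> i _; exact: (nextP _ (Ct i)).2.
rewrite /splice; case: ltnP => [kn|_]; last exact: Ct.
by apply: Cs; exact: ltnW.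
Qed.

(** A word from [a] to [b] may be a single letter; a first step inside [C] ensures positive
    length. *)
Lemma irreducible_reach C a b : irreducible C -> C a -> C b -> reach a b.
Proof.
move=> irr Ca Cb.
have /language_starts_ends[s [k [_ [[sM Cs] <- _]]]] := irr a a Ca Ca.
have ab : reach (s k) (s k.+1).
  by apply: (@Mpath_reach s k.+1); [exact: Sigma_M_Mpath|rewrite ltnSn/=].
have /language_starts_ends[t [i [n [[tM Ct] ti tn]]]] := irr _ _ (Cs k.+1) Cb.
case: n tn => [|n] tn; first by rewrite addn0 ti in tn; rewrite -tn.
apply: (reach_trans ab); rewrite -ti -tn; apply: (@Mpath_reach t (i + n.+1)).
  exact: Sigma_M_Mpath.
by rewrite leqnn andbT; lia.
Qed.

Definition component a : set (symb F) := [set c | reach a c /\ reach c a].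

Lemma component_Mpath a s n : component a (s 0%N) -> component a (s n) ->
  Mpath n s -> forall k, (k <= n)%N -> component a (s k).
Proof.
move=> [as0 s0a] [asn sna] sM k kn; split.
  case: k kn => // k kn; apply: (reach_trans as0).
  by apply: Mpath_reach sM _; rewrite kn.
move: kn; rewrite leq_eqVlt => /predU1P[->//|kn].
by apply: (reach_trans _ sna); apply: Mpath_reach sM _; rewrite kn leqnn.
Qed.

Lemma component_reach a c d : component a c -> component a d -> reach c d.
Proof. by move=> [_ ca] [ad _]; exact: reach_trans ca ad. Qed.

Lemma component_irreducible a : irreducible (component a).
Proof.
have next c : component a c -> exists2 d, component a d & M c d.
  move=> Cc; have [s [n [n0 s0 sn sM]]] := component_reach Cc Cc.
  have Cs := @component_Mpath a s n; rewrite s0 sn in Cs.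
  by exists (s 1%N); [exact: Cs|rewrite -s0; exact: sM].
move=> c d Cc Cd; have [s [n [n0 s0 sn sM]]] := component_reach Cc Cd.
have Cs := @component_Mpath a s n; rewrite s0 sn in Cs.
have [t tC ts] := Mpath_extend next (Cs Cc Cd sM) sM.
apply/language_starts_ends; exists t, 0%N, n; split => //.
  by rewrite ts.
by rewrite add0n ts.
Qed.

Lemma component_maximal a C : reach a a -> irreducible C -> component a `<=` C ->
  C = component a.
Proof.
move=> aa irr sub; apply/seteqP; split => // c Cc.
have Ca : C a by apply: sub; split.
by split; exact: (irreducible_reach irr).
Qed.

Lemma irreducible_componentE C a : irreducible_component C -> C a ->
  C = component a.
Proof.
move=> [irr max] Ca; apply/esym/max; first exact: component_irreducible.
by move=> c Cc; split; exact: (irreducible_reach irr).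
Qed.

(** Pigeonhole: an infinite path in a finite alphabet repeats a symbol. *)
Lemma recurrent_symbol s : Sigma_M s -> exists a, reach a a.
Proof.
move=> sM; have : ~ injective (fun i : 'I_(#|symb F|.+1) => s i).
  by move=> /leq_card; rewrite card_ord ltnn.
move=> /existsNP[i /existsNP[j /not_implyP[sij ij]]].
wlog lt_ij : i j sij ij / (i < j)%N.
  move=> H; case: (ltngtP i j) => [|ji|/val_inj//]; first exact: H.
  by apply: (H j i) => // ij'; apply: ij; rewrite ij'.
exists (s i); rewrite {2}sij; apply: (@Mpath_reach s j); last by rewrite lt_ij /=.
exact: Sigma_M_Mpath.
Qed.

(** * Transitivity implies irreducibility *)

Context (F_proper : properly_parametrized F).

Lemma trajectory_code_Sigma x s : (forall n, coded n s x) -> Sigma_M s.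
Proof. by move=> sx k; exact: (coded_Mpath (sx k.+2)). Qed.

Lemma essential_reach a b : topologically_transitive (@T R F) ->
  essential_symbols a -> essential_symbols b -> reach a b.
Proof.
move=> tr /(essential_cylinder F_proper)[n [s [oU U0 [i ni <-]]]].
move=> /(essential_cylinder F_proper)[m [t [oV V0 [j mj <-]]]].
(* Taking the preimage of the second cylinder under [n] steps puts [b] after [a] in the code, as [a]
   occurs before time [n]. *)
have := tr _ _ oU (open_T_preimage n oV) U0 (T_preimage_nonempty n tr oV V0).
move=> [l [_ [[x /= sx <-] /= tx]]].
have [r rx] := trajectory_coded F_proper (set_valX x).
have -> : s i = r i by exact: (coded_inj F_proper sx (rx n)).
have -> : t j = r (j + n + l)%N.
  apply: (coded_inj F_proper tx (t := fun k => r (k + n + l)%N) _ mj) => k _.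
  by rewrite !iter_T; exact: rx (k + n + l).+1 _ (leqnn _).
apply: (@Mpath_reach r (j + n + l)); last by rewrite leqnn andbT; lia.
exact: Sigma_M_Mpath (trajectory_code_Sigma rx).
Qed.

Lemma transitive_irreducibility :
  topologically_transitive (@T R F) -> irreducibility_condition F.
Proof.
move=> tr.
suff [a aa esub] : exists2 a, reach a a & @essential_symbols R F `<=` component a.
  exists (component a) => //; split; first exact: component_irreducible.
  by move=> C irr sub; exact: component_maximal.
have [[a ea]|/forallNP ne] := pselect (exists a : symb F, essential_symbols a).
  exists a; first exact: essential_reach.
  by move=> b eb; split; exact: essential_reach.
(* Without essential symbols, the class of any recurrent symbol serves. *)
have [x Fx _] : exists2 x, trajectories F x & x 0%N = 0.
  by apply: trajectory_start; rewrite lexx ler01.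
have [s sx] := trajectory_coded F_proper Fx.
have [a aa] := recurrent_symbol (trajectory_code_Sigma sx).
by exists a => // b /ne.
Qed.

(** Only symbols of class 2 can change under small perturbation, so a single letter of class 0 is
    locally coded. *)
Lemma Class0_essential a : class_of a = Class0 -> essential_symbols a.
Proof.
move=> Ea; have [//|x' ax'] := @Mpath_coded R F F_proper 0 (fun=> a).
have [x Fx xx'] := coded_extend (ltn0Sn 0) ax'.
have [s sx] := trajectory_coded F_proper Fx.
have -> : a = s 0%N.
  apply: (Gr0_inj F_proper) (sx 1%N 0%N (leqnn _)).
  by rewrite !xx'//; exact: ax'.
apply: (locally_coded_essential F_proper sx (n := 1)) => //.
have [e e0 eP] := code_near_segment F_proper (sx 1%N).
exists e => // y Fy xy; have [t ty] := trajectory_coded F_proper Fy.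
move=> [|//] _; have [//|<-|[]] := eP t y (ty 1%N) xy 0%N; first exact: ty 1%N 0%N _.
have -> : s 0%N = a; last by rewrite /class2b Ea.
apply: (Gr0_inj F_proper) (sx 1%N 0%N (leqnn _)) _.
by rewrite !xx'//; exact: ax'.
Qed.

End Symbolic_dynamics.

(** * Cylinders inside open sets *)

Section Coding.
Context {R : realType} (F : Markov_multimap R).
Implicit Types (a b c : symb F) (C : set (symb F)) (s t : nat -> symb F).
Context (F_proper : properly_parametrized F).

Lemma weakly_coded_I s x n : weakly_coded n.+1 s x ->
  I_ [seq s i | i <- iota 0 n.+1] (x 0%N).
Proof.
move=> sx; exists (x n.+1); last first.
  by rewrite (weakly_coded_preorbit sx (leq0n _)) /preorbit subn0.
have [Rx _] := Gr_inverse (sx n (leqnn _)).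
by rewrite last_map_iota.
Qed.

Lemma I_sub01 s n : Mpath n s -> I_ [seq s i | i <- iota 0 n.+1] `<=` `[0, 1].
Proof.
move=> sM _ [v + <-].
rewrite last_map_iota.
move=> /(preorbit_weakly_coded sM)/(_ 0%N isT)/Gr_Dom/Dom01.
by rewrite /preorbit subn0.
Qed.

Lemma ell_ge (I : set R) u v : I `<=` `[0, 1] -> I u -> I v -> `|u - v| <= ell I.
Proof.
move=> I01 Iu Iv.
have hs : has_sup I.
  by split; [exists u|exists 1 => w /I01; rewrite /= in_itv/= => /andP[]].
have hi : has_inf I.
  by split; [exists u|exists 0 => w /I01; rewrite /= in_itv/= => /andP[]].
have h1 := sup_upper_bound hs Iu; have h2 := sup_upper_bound hs Iv.
have h3 := ge_inf hi.2 Iu; have h4 := ge_inf hi.2 Iv.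
by rewrite /ell ler_norml; apply/andP; split; lra.
Qed.

(** Symbols of [Z] reach one another, so a single one in [C] puts them all in its strongly connected
    class. *)
Lemma coding_symbols C Z a b : irreducible_component C ->
  @transitive_on_symbols R F Z -> Z `<=` @Sigma_M R F ->
  C b -> words Z [tuple b] -> words Z [tuple a] -> C a.
Proof.
move=> iC trZ ZM Cb wb wa; have CE := irreducible_componentE iC Cb.
have Zreach c d : words Z [tuple c] -> words Z [tuple d] -> c = d \/ reach c d.
  move=> wc /(trZ _ _ wc)/language_starts_ends[s [k [n [/ZM sM <- <-]]]].
  case: n => [|n]; first by left; rewrite addn0.
  right; apply: (@Mpath_reach _ _ s (k + n.+1)); first exact: Sigma_M_Mpath.
  by rewrite leqnn andbT; lia.
have [<-//|ba] := Zreach b a wb wa; have [->//|ab] := Zreach a b wa wb.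
by rewrite CE.
Qed.

Lemma words_symbol (Z : set (nat -> symb F)) s k : Z s -> words Z [tuple s k].
Proof.
by move=> Zs; exists s => //; exists k => i; rewrite (ord1 i) addn0.
Qed.

(** The midpoint of the first cell is not in [P], so any symbol coding it is of class 0, hence
    essential. *)
Lemma coding_symbol_essential (Z : set (nat -> symb F)) :
  (forall y, `[0, 1]%classic y -> exists s (x : nat -> R),
      [/\ Z s, trajectories F x, x 0%N = y & forall i, Gr (s i) (x i, x i.+1)]) ->
  exists2 a, essential_symbols a & words Z [tuple a].
Proof.
move=> cover; have ax := multimap_axioms F.
have r0 : (0 < nparts F)%N.
  rewrite lt0n; apply/eqP => E; have := pt_last ax.
  by rewrite E (pt_first ax) => /esym/eqP; rewrite oner_eq0.
have [h1 h2] := midf_lt (pt_increasing ax r0).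
set y := (_ + _) / 2 in h1 h2.
have nP : ~ partition_points F y by apply: (partition_point_gap r0); rewrite h1.
have y01 : `[0, 1]%classic y.
  rewrite /= in_itv/=.
  have : 0 <= pt F 1 <= 1 by apply: (@partition_points01 _ F); exists 1%N => /=.
  move=> /andP[_ p1]; rewrite (le_trans (ltW h2) p1) andbT.
  by rewrite -(pt_first ax) ltW.
have [s [x [Zs _ xy sx]]] := cover y y01.
exists (s 0%N); last exact: words_symbol.
apply: Class0_essential => //; have := Gr_Dom (sx 0%N); rewrite xy.
case E : (class_of (s 0%N)) => //; move=> /Dom_point; rewrite E => /(_ _)yE;
  by exfalso; apply: nP; rewrite yE//; exact: (Dom_ends _).1.
Qed.

(* Essential symbols fix the coordinates up to the
   last one seen by U; the coding condition pins down that last coordinate. *)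
Lemma open_cylinder C (U : set (X F)) : coding_condition F ->
  irreducible_component C -> @essential_symbols R F `<=` C ->
  open U -> U !=set0 ->
  exists n s, [/\ Mpath n s, C (s 0%N), C (s n) &
    forall x : X F, weakly_coded n.+1 s (set_val x) -> U x].
Proof.
move=> [Z [[ZM _ _] trZ cover lim]] iC eC /open_close oU [x0 Ux0].
have CZ s k : Z s -> C (s k).
  have [b /eC Cb wb] := coding_symbol_essential cover.
  by move=> Zs; apply: (coding_symbols iC trZ ZM Cb wb); exact: words_symbol.
have [N [e e0 eU]] := oU _ Ux0.
(* One coordinate beyond those seen by [U] provides at least one symbol, and the point [y N.+1] at
   which the coding by [Z] starts. *)
have [||y [s [Fy Wy sy loc]]] := @exists_locally_coded R F F_proper N.+1
    (close N.+1 e (set_val x0)) _ (set_val x0) (set_valX x0).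
- move=> x _ /close_open[d d0 dP]; exists d => // z _; exact: dP.
- by move=> k _; rewrite subrr normr0.
have Cs k : (k < N.+1)%N -> C (s k).
  by move=> kN; apply: eC; exact: (locally_coded_essential F_proper sy loc).
have [d d0 dP] := close_open Wy.
have [c c0 cP] := weakly_coded_close (coded_weak (sy N.+1)) d0.
have UP z : weakly_coded N.+1 s (set_val z) ->
    `|set_val z N.+1 - y N.+1| < c -> U z.
  move=> sz zy; apply: eU => k kN; apply: (dP _ (cP _ sz zy)).
  exact: leqW.
have sM : Mpath N s := coded_Mpath (sy N.+1).
(* After a symbol of class 2 the last coordinate is forced, so no [Z]-word is needed. *)
have [E2|nE2] := pselect (class_of (s N) = Class2).
  exists N, s; split => //; [exact: Cs|exact: Cs|].
  move=> z sz; apply: UP => //.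
  have [_ ->] := Class2_partition_points E2 (sz N (leqnn _)).
  have [_ ->] := Class2_partition_points E2 (Gr0_sub (sy N.+1 N (leqnn _))).
  by rewrite subrr normr0.
have [|t [w [Zt _ wy tw]]] := cover (y N.+1); first by have [] := Fy.
have Mst : M (s N) (t 0%N).
  apply/asboolP; apply: (@Dom0_sub_Rng0 _ _ _ _ (y N.+1)).
  - exact: Gr0_Rng0 (sy N.+1 N (leqnn _)).
  - by rewrite -wy; exact: Gr_Dom (tw 0%N).
  - by left.
(* Long enough that points starting orbit segments with the first [m.+1] symbols of [t] differ by
   less than [c]. *)
have [m mP] : exists m, ell (I_ [seq t i | i <- iota 0 m.+1]) < c.
  have /cvgrPdist_lt/(_ _ c0)[m _ /(_ m.+1 (leqnSn m))] := lim.
  rewrite sub0r normrN => lt_c; exists m; apply: le_lt_trans lt_c.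
  apply: le_trans (ler_norm _).
  apply: (@le_bigmax_cond _ _ _ _ (map_tuple t (iota_tuple m.+1 0))
    (fun u : m.+1.-tuple _ => `[< words Z u >]) (fun u : m.+1.-tuple _ => ell (I_ u))).
  apply/asboolP; exists t => //; exists 0%N => i.
  by rewrite tnth_map (tnth_nth 0%N) nth_iota.
have tM : Mpath m t by apply: Sigma_M_Mpath; exact: ZM.
exists (N.+1 + m)%N, (splice N.+1 s t); split.
- move=> k kNm; rewrite /splice; have [kN|Nk] := ltnP k N.+1.
    have [kN'|Nk'] := ltnP k.+1 N.+1; first exact: sM.
    have -> : k = N by lia.
    by rewrite subnn.
  by rewrite ltnNge (leqW Nk)/= subSn//; apply: ZM.
- by rewrite /splice/=; exact: Cs.
- by rewrite splice_addE; exact: CZ.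
- move=> z rz; apply: UP.
    move=> k kN; have := rz k; rewrite /splice kN; apply; lia.
  have tz : weakly_coded m.+1 t (fun k => set_val z (N.+1 + k)%N).
    move=> k km; have := rz (N.+1 + k)%N; rewrite splice_addE addnS; apply; lia.
  apply: le_lt_trans mP; rewrite -{1}[N.+1]addn0 -wy; apply: ell_ge.
  - exact: I_sub01.
  - exact: (weakly_coded_I tz).
  - by apply: weakly_coded_I => k _; exact: tw.
Qed.

(** * Transitivity and dense periodic points *)

Section Irreducible.
Context (C : set (symb F)) (cc : coding_condition F)
  (iC : irreducible_component C) (eC : @essential_symbols R F `<=` C).

(** The words found for [U] and [V] end and begin in [C], so a path joins them, and any trajectory
    coded by the concatenation goes from [U] to [V]. *)
Lemma coding_transitive : topologically_transitive (@T R F).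
Proof.
move=> U V oU oV U0 V0.
have [n [s [sM _ Csn sU]]] := open_cylinder cc iC eC oU U0.
have [m [t [tM Ct0 _ tV]]] := open_cylinder cc iC eC oV V0.
have [p [l [l0 p0 pl pM]]] := irreducible_reach iC.1 Csn Ct0.
pose q := splice l p t; pose r := splice n s q.
have q0 : s n = q 0%N by rewrite /q spliceE.
have qM : Mpath (l + m) q.
  exact: (@splice_step _ unit l p t (fun=> tt) (fun=> tt) (fun _ a b => M a b)).
have rM : Mpath (n + (l + m)) r.
  exact: (@splice_step _ unit n s q (fun=> tt) (fun=> tt) (fun _ a b => M a b)).
have [x rx] := Mpath_coded F_proper rM.
have [y Fy yx] := coded_extend (ltn0Sn _) rx.
have ry : weakly_coded (n + (l + m)).+1 r y.
  by move=> k kn; rewrite !yx ?(ltnW kn)//; exact: Gr0_sub (rx k kn).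
exists (n + l)%N; exists (iter (n + l) (@T R F) (to_X Fy)); split.
  exists (to_X Fy) => //; apply: sU => k kn.
  by rewrite -(@spliceE _ n s q k q0 kn); apply: ry; lia.
apply: tV => k km; rewrite !iter_T.
have -> : t k = r (k + (n + l))%N.
  by rewrite addnC -addnA /r splice_addE /q splice_addE.
by apply: ry; lia.
Qed.

(** The inverse branch of the cycle maps the range of its last symbol continuously into itself; a
    fixed point closes up the orbit. *)
Lemma cycle_periodic_point s n : (0 < n)%N -> Mpath n s -> s n = s 0%N ->
  exists2 x, forall k, Gr (s (k %% n)%N) (x k, x k.+1) & forall k, x (k + n)%N = x k.
Proof.
case: n => // n _ sM sn.
have sMn : Mpath n s by move=> k kn; exact: sM k (ltnW kn).
pose h v := preorbit s n.+1 v 0%N.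
have hR v : Rng (s n) v -> Rng (s n) (h v).
  move=> /(preorbit_weakly_coded sMn)/(_ 0%N isT)/Gr_Dom.
  by apply: MDom; rewrite -sn; exact: sM.
have hc := @preorbit_continuous R F n s 0 sMn isT.
have [v Rv hv] : exists2 v, Rng (s n) v & h v = v.
  have lohi := rlo_le_rhi (s n).
  (* The difference [h v - v] is nonnegative at the left end and nonpositive at the right end. *)
  have [||v vI /eqP] := @IVT R (fun v => h v - v) _ _ 0 lohi.
  - apply/within_continuous_epsP => v Rv e e0.
    have e20 : 0 < e / 2 by rewrite divr_gt0.
    have /within_continuous_epsP/(_ v Rv _ e20)[d d0 dP] := hc.
    exists (Num.min d (e / 2)); first by rewrite lt_min d0.
    move=> w Rw; rewrite lt_min => /andP[/(dP w Rw) h1 h2].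
    have -> : h w - w - (h v - v) = (h w - h v) - (w - v) by lra.
    apply: le_lt_trans (ler_normB _ _) _.
    by rewrite [ltRHS]splitr ltrD.
  - have lo : Rng (s n) (rlo (s n)) by rewrite /Rng /= in_itv/= lexx.
    have hi : Rng (s n) (rhi (s n)) by rewrite /Rng /= in_itv/= lexx andbT.
    have := hR _ lo; have := hR _ hi; rewrite /Rng /= !in_itv/=.
    move=> /andP[_ h1] /andP[h2 _].
    by rewrite ge_min le_max !subr_ge0 !subr_le0 h1 h2 orbT.
  - by rewrite subr_eq0 => /eqP; exists v.
pose z k := preorbit s n.+1 v (k %% n.+1)%N.
exists z; last by move=> k; rewrite /z modnDr.
move=> k; have kn : (k %% n.+1 < n.+1)%N by rewrite ltn_mod.
have := preorbit_weakly_coded sMn Rv kn; congr (Gr _ (_, _)).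
rewrite /z -[k.+1]addn1 -modnDml addn1.
have [kn'|nk] := ltnP (k %% n.+1).+1 n.+1; first by rewrite (modn_small kn').
(* At the wrap-around the orbit ends in [v], which equals its starting point [h v]. *)
have -> : (k %% n.+1).+1 = n.+1 by apply/eqP; rewrite eqn_leq kn nk.
by rewrite modnn preorbit_end -/(h v) hv.
Qed.

Lemma coding_dense_periodic : dense (periodic_points (@T R F)).
Proof.
move=> U U0 oU.
have [n [s [sM Cs0 Csn sU]]] := open_cylinder cc iC eC oU U0.
have [p [l [l0 p0 pl pM]]] := irreducible_reach iC.1 Csn Cs0.
(* A cycle, since [p] leads from [s n] back to [s 0]; as [l] is positive, one period contains all of
   [s 0, ..., s n]. *)
pose r := splice n s p.
have sp : s n = p 0%N by [].
have rM : Mpath (n + l) r.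
  exact: (@splice_step _ unit n s p (fun=> tt) (fun=> tt) (fun _ a b => M a b)).
have nl0 : (0 < n + l)%N by rewrite addn_gt0 l0 orbT.
have [|x rx xper] := cycle_periodic_point nl0 rM.
  by rewrite /r splice_addE spliceE.
have Fx : trajectories F x.
  by apply: (@weakly_coded_trajectory _ _ (fun k => r (k %% (n + l))%N)) => m k _.
exists (to_X Fx); split; last first.
  exists (n + l)%N => //; apply: X_inj => k.
  by rewrite iter_T; exact: xper.
apply: sU => k kn; rewrite -(@spliceE _ n s p k sp kn).
have := rx k; rewrite modn_small//; lia.
Qed.

End Irreducible.
End Coding.

Theorem theorem5p1 (R : realType) (F : Markov_multimap R)
    (F_proper : properly_parametrized F) :
  (topologically_transitive (@T R F) -> irreducibility_condition F) /\
  (coding_condition F -> irreducibility_condition F ->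
     topologically_transitive (@T R F) /\ dense (periodic_points (@T R F))).
Proof.
split; first exact: transitive_irreducibility.
move=> cc [C iC eC]; split.
  exact: (coding_transitive F_proper cc iC eC).
exact: (coding_dense_periodic F_proper cc iC eC).
Qed.
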